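(* For $n\ge1$, let $\mathcal{B}_n$ (resp. $\mathcal{B}'_n$) be the set of faro permutations of length $n$ avoiding the classical pattern $2\text{-}3\text{-}1$ (resp. $3\text{-}1\text{-}2$). Then: (1) the cardinality of $\mathcal{B}_n$ is $f_n$, where $(f_n)_{n\ge1}$ is the Fibonacci sequence defined by $f_1=1$, $f_2=2$ and $f_n=f_{n-1}+f_{n-2}$ for $n\ge3$; (2) $\mathcal{B}_n=\mathcal{B}'_n$; (3) $\mathcal{B}_n$ is exactly the set of faro involutions of length $n$ (faro permutations of length $n$ that are involutions).
   Context: A faro permutation of length $n$ is a permutation $w=w_1\cdots w_n$ of $\{1,\dots,n\}$ obtained by interlacing two increasing words $u,v$ as $u_1v_1u_2v_2\cdots$ with $0\le|u|-|v|\le1$ (equivalently, $w_i<w_{i+2}$ for all $1\le i\le n-2$). A permutation $w$ avoids the classical pattern $p_1\text{-}p_2\text{-}p_3$ if there are no indices $i_1<i_2<i_3$ (not necessarily consecutive) such that $w_{i_1}w_{i_2}w_{i_3}$ is order-isomorphic to $p_1p_2p_3$. *)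

(* Defs.v *)
From mathcomp Require Import all_boot all_fingroup.

Set Implicit Arguments.
Unset Strict Implicit.
Unset Printing Implicit Defensive.

(* Permutations of length n are elements of 'S_n, so positions and letters
   both range over {0, .., n-1} instead of {1, .., n}. *)

Definition one_line n (w : 'S_n) : seq 'I_n := [seq w i | i <- enum 'I_n].

(* u_1 v_1 u_2 v_2 ... ; once one word is exhausted, the rest of the other
   one is appended (at most one letter when |v| <= |u| <= |v| + 1). *)
Fixpoint interlace (T : Type) (u v : seq T) : seq T :=
  match u, v with
  | [::], _ => v
  | _, [::] => u
  | x :: u', y :: v' => x :: y :: interlace u' v'
  end.

Definition increasing_word n (u : seq 'I_n) : bool :=
  sorted (fun i j : 'I_n => i < j) u.

(* Bounding the lengths of u and v by n loses nothing, since their lengths add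
   up to n; it makes the existential quantifiers range over finite types. *)
Definition faro n (w : 'S_n) : bool :=
  [exists u : n.-bseq 'I_n, exists v : n.-bseq 'I_n,
    [&& increasing_word u, increasing_word v,
        size v <= size u <= (size v).+1 & one_line w == interlace u v]].

(* Only the relative order of the entries of p matters, so patterns can be
   written with the usual letters 1, .., k. *)
Definition contains_pattern (p : seq nat) n (w : 'S_n) : bool :=
  [exists i : (size p).-tuple 'I_n,
    increasing_word i &&
    [forall a : 'I_(size p), forall b : 'I_(size p),
      (w (tnth i a) < w (tnth i b)) == (nth 0 p a < nth 0 p b)]].

Definition avoids_pattern (p : seq nat) n (w : 'S_n) : bool :=
  ~~ contains_pattern p w.

Definition is_involution n (w : 'S_n) : bool := [forall i, w (w i) == i].

Definition faro_avoiders (p : seq nat) n : {set 'S_n} :=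
  [set w : 'S_n | faro w && avoids_pattern p w].

Definition faro_B n : {set 'S_n} := faro_avoiders [:: 2; 3; 1] n.
Definition faro_B' n : {set 'S_n} := faro_avoiders [:: 3; 1; 2] n.

Definition faro_involutions n : {set 'S_n} :=
  [set w : 'S_n | faro w && is_involution w].

(* f_1 = 1, f_2 = 2; the value at 0 is a convention making the recurrence
   also hold at 2. *)
Fixpoint fib (n : nat) : nat :=
  match n with
  | 0 => 1
  | 1 => 1
  | (m.+1 as k).+1 => fib k + fib m
  end.

(* Main.v *)
Require Import Defs.
From mathcomp Require Import all_boot all_fingroup.
From mathcomp Require Import zify.

Set Implicit Arguments.
Unset Strict Implicit.
Unset Printing Implicit Defensive.

(** All three sets coincide with a fourth one, easy to count: the permutations
    that move every point by at most one, here called near-identities.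

    A permutation is a near-identity exactly when it has no far inversion, that
    is, no i, j with i + 2 <= j and w j < w i ([near_identityP]).  On the other
    side, a permutation is faro exactly when it increases along positions of
    the same parity ([faroP]); so a near-identity is faro, and the positions of
    a far inversion i, j of a faro permutation have opposite parities.  Then
    j - 1 lies in the parity class of i, beyond i, so w (j - 1) > w i and
    i, j - 1, j is an occurrence of 2-3-1; dually i, i + 1, j is an occurrence
    of 3-1-2.  Conversely the first and last entries of an occurrence of either
    pattern form a far inversion.  This gives B_n = B'_n = near-identities
    ([faro_avoids231], [faro_avoids312]).

    A near-identity is an involution because a point moved one step up must be
    swapped with its successor, once everything below it is known to be settled
    ([near_identity_involution]).  In the other direction, a faro involution
    with w i >= i + 2 would yield a smaller point of the same kind, namely
    w (i + 1) ([faro_involution_le]).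

    Finally a near-identity on n + 2 points either fixes the last point, or
    swaps the last two; removing them leaves an arbitrary near-identity on n + 1
    or n points, which is the Fibonacci recurrence ([card_near_identity]). *)

(** * Faro permutations as parity-wise increasing ones *)

(** The size condition is what keeps the two words alternating to the very end:
    otherwise the tail of the longer one would be appended at both parities. *)
Lemma nth_interlace (T : Type) (x0 : T) (u v : seq T) (k : nat) :
  size v <= size u <= (size v).+1 ->
  nth x0 (interlace u v) k = nth x0 (if odd k then v else u) k./2.
Proof.
elim: u v k => [|x u IHu] [|y v] k //.
- by case: (odd k); rewrite !nth_nil.
- case: u {IHu} => // _; case: k => [|[|k]] //.
  by rewrite !nth_default //; case: ifP.
- rewrite /= !ltnS => /IHu IH; case: k => [|[|k]] //=.
  by rewrite negbK IH; case: (odd k).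
Qed.

Lemma size_interlace (T : Type) (u v : seq T) :
  size (interlace u v) = size u + size v.
Proof.
elim: u v => [|x u IHu] [|y v] //=; first by rewrite addn0.
by rewrite IHu addnS.
Qed.

Lemma size_one_line n (w : 'S_n) : size (one_line w) = n.
Proof. by rewrite size_map size_enum_ord. Qed.

Lemma nth_one_line n (w : 'S_n) (x0 i : 'I_n) : nth x0 (one_line w) i = w i.
Proof. by rewrite (nth_map x0) ?size_enum_ord // nth_ord_enum. Qed.

(** The words u and v of an interlacing are the entries of w at even and at odd
    positions, so their monotonicity is that of w within each parity class. *)
Lemma faroP n (w : 'S_n) :
  reflect (forall i j : 'I_n, i < j -> odd i = odd j -> w i < w j) (faro w).
Proof.
have lt_trans : transitive (fun i j : 'I_n => i < j).
  by move=> ? ? ?; apply: ltn_trans.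
apply: (iffP idP) => [faro_w i j lt_ij odd_ij | inc_w].
- have [u [v [inc_u inc_v size_uv w_uv]]] : exists u v : seq 'I_n,
      [/\ increasing_word u, increasing_word v,
          size v <= size u <= (size v).+1 & one_line w = interlace u v].
    case/existsP: faro_w => u /existsP[v /and4P[? ? ? /eqP ?]].
    by exists u, v.
  have inc_uv b : increasing_word (if b then v else u) by case: b.
  have size_n : size u + size v = n.
    by rewrite -size_interlace -w_uv size_one_line.
  rewrite -!(nth_one_line w i) w_uv !nth_interlace // odd_ij.
  apply: (sorted_ltn_nth lt_trans i (inc_uv (odd j))); rewrite ?inE;
    by move: (ltn_ord i) (ltn_ord j); case: (boolP (odd j)) odd_ij => ? ?; lia.
- case: n => [|n] in w lt_trans inc_w *.
    apply/existsP; exists [bseq]; apply/existsP; exists [bseq].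
    by apply/and4P; split=> //; rewrite -size_eq0 size_one_line.
  (* The two words are read off the even and the odd positions; there is one
     more even position when the length is odd, whence the upper half. *)
  pose word b k := mkseq (fun h => nth ord0 (one_line w) (h.*2 + b)) k.
  have word_inc b k : k.*2 + b <= n.+2 -> increasing_word (word b k).
    move=> le_k; apply/(sortedP ord0) => h; rewrite size_mkseq => lt_h.
    rewrite !nth_mkseq //; last lia.
    have lt1 : h.*2 + b < n.+1 by lia.
    have lt2 : h.+1.*2 + b < n.+1 by lia.
    rewrite (nth_one_line w ord0 (Ordinal lt1)).
    rewrite (nth_one_line w ord0 (Ordinal lt2)).
    by apply: inc_w => /=; lia.
  set u := word 0 (uphalf n.+1); set v := word 1 n.+1./2.
  have le_u : size u <= n.+1 by rewrite size_mkseq; lia.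
  have le_v : size v <= n.+1 by rewrite size_mkseq; lia.
  have size_uv : size v <= size u <= (size v).+1.
    by rewrite !size_mkseq; lia.
  apply/existsP; exists (Bseq le_u); apply/existsP; exists (Bseq le_v).
  apply/and4P; split=> //; try (apply: word_inc; lia).
  apply/eqP/(@eq_from_nth _ ord0) => [|k].
    by rewrite size_interlace size_one_line !size_mkseq; lia.
  rewrite size_one_line nth_interlace // => lt_k.
  case: ifP => odd_k; rewrite nth_mkseq; try lia; congr nth; lia.
Qed.

(** * Occurrences of the two patterns *)

Lemma increasing_tnth n m (t : m.-tuple 'I_n) (a b : 'I_m) :
  increasing_word t -> a < b -> tnth t a < tnth t b.
Proof.
have x0 := tnth t a; move=> inc_t ab; rewrite !(tnth_nth x0).
apply: (sorted_ltn_nth _ _ inc_t); rewrite ?inE ?size_tuple //.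
by move=> ? ? ?; apply: ltn_trans.
Qed.

Lemma contains231P n (w : 'S_n) :
  reflect (exists i j k : 'I_n, [/\ i < j, j < k, w k < w i & w i < w j])
          (contains_pattern [:: 2; 3; 1] w).
Proof.
apply: (iffP existsP) => [[t /andP[inc_t /'forall_forallP pat_t]] |
                         [i [j [k [ij jk wki wij]]]]].
- pose p k lt : 'I_3 := @Ordinal 3 k lt.
  exists (tnth t (p 0 isT)), (tnth t (p 1 isT)), (tnth t (p 2 isT)).
  split; try exact: increasing_tnth.
  + by rewrite (eqP (pat_t (p 2 isT) (p 0 isT))).
  + by rewrite (eqP (pat_t (p 0 isT) (p 1 isT))).
- exists [tuple i; j; k]; rewrite /increasing_word /= ij jk /=.
  apply/'forall_forallP => -[[|[|[|//]]] lta] [[|[|[|//]]] ltb];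
    rewrite !(tnth_nth i) /=; lia.
Qed.

Lemma contains312P n (w : 'S_n) :
  reflect (exists i j k : 'I_n, [/\ i < j, j < k, w j < w k & w k < w i])
          (contains_pattern [:: 3; 1; 2] w).
Proof.
apply: (iffP existsP) => [[t /andP[inc_t /'forall_forallP pat_t]] |
                         [i [j [k [ij jk wjk wki]]]]].
- pose p k lt : 'I_3 := @Ordinal 3 k lt.
  exists (tnth t (p 0 isT)), (tnth t (p 1 isT)), (tnth t (p 2 isT)).
  split; try exact: increasing_tnth.
  + by rewrite (eqP (pat_t (p 1 isT) (p 2 isT))).
  + by rewrite (eqP (pat_t (p 2 isT) (p 0 isT))).
- exists [tuple i; j; k]; rewrite /increasing_word /= ij jk /=.
  apply/'forall_forallP => -[[|[|[|//]]] lta] [[|[|[|//]]] ltb];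
    rewrite !(tnth_nth i) /=; lia.
Qed.

(** * Permutations moving every point by at most one *)

Definition near_identity n (w : 'S_n) : bool :=
  [forall i, (w i <= i.+1) && (i <= (w i).+1)].

Lemma card_ord_lt n m : m <= n -> #|[set j : 'I_n | j < m]| = m.
Proof.
move=> le_mn; have widen_inj : injective (widen_ord le_mn).
  by move=> i j /(congr1 val) /= /val_inj.
rewrite -[RHS](card_ord m) -(card_imset _ widen_inj).
apply: eq_card => j; rewrite inE; apply/idP/imsetP => [lt_jm | [i _ ->]] //=.
by exists (Ordinal lt_jm) => //; apply: val_inj.
Qed.

(** Counts the value w i by the positions of the values below it: this is how
    information on inversions turns into a bound on w i. *)
Lemma card_perm_lt n (w : 'S_n) (i : 'I_n) : #|[set j | w j < w i]| = w i.
Proof.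
rewrite -[RHS](@card_ord_lt n) 1?ltnW //.
rewrite -[RHS](card_preimset _ (@perm_inj _ w)).
by apply: eq_card => j; rewrite !inE.
Qed.

(** Without far inversions, every position before i - 1 carries a smaller value
    than i, and smaller values sit only at positions up to i + 1, other than i;
    hence i - 1 <= w i <= i + 1.  Conversely, if i + 2 <= j then
    w i <= i + 1 <= j - 1 <= w j, and equality is excluded by injectivity. *)
Lemma near_identityP n (w : 'S_n) :
  reflect (forall i j : 'I_n, i.+1 < j -> w i < w j) (near_identity w).
Proof.
apply: (iffP forallP) => [near_w i j lt_ij | sep_w i].
  case/andP: (near_w i) (near_w j) => ? _ /andP[_ ?].
  rewrite ltn_neqAle; apply/andP; split; last lia.
  by apply: contraTneq lt_ij => /val_inj/perm_inj ->; lia.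
apply/andP; split.
- case: (leqP n i.+2) => [|lt_n]; first exact: (leq_trans (ltn_ord (w i))).
  suff : #|[set j | w j < w i]| < #|[set j : 'I_n | j < i.+2]|.
    by rewrite card_perm_lt card_ord_lt // ltnW.
  apply/proper_card/properP; split; last by exists i; rewrite !inE ?ltnn.
  apply/subsetP => j; rewrite !inE => w_ji.
  by case: (leqP i.+2 j) => // /sep_w; lia.
- have : #|[set j : 'I_n | j < i.-1]| <= w i; last first.
    by rewrite card_ord_lt; move: (ltn_ord i); lia.
  rewrite -card_perm_lt; apply/subset_leq_card/subsetP => j.
  rewrite !inE => lt_j.
  by apply: sep_w; lia.
Qed.

(** * Pattern avoidance and involutivity *)

Lemma near_identity_faro n (w : 'S_n) : near_identity w -> faro w.
Proof.
by move/near_identityP => sep_w; apply/faroP => i j ? ?; apply: sep_w; lia.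
Qed.

(** The parity statement is what lets the far inversion be completed to a
    pattern, by a third entry adjacent to one of its ends. *)
Lemma faro_far_inversion n (w : 'S_n) :
  faro w -> ~~ near_identity w ->
  exists i j : 'I_n, [/\ i.+1 < j, w j < w i & odd i != odd j].
Proof.
move=> /faroP inc_w not_near.
have /existsP[i /existsP[j /andP[lt_ij ge_ij]]] :
    [exists i : 'I_n, exists j : 'I_n, (i.+1 < j) && (w j <= w i)].
  apply: contraNT not_near => no_inv; apply/near_identityP => i j lt_ij.
  rewrite ltnNge; apply: contra no_inv => ge_ij.
  by apply/existsP; exists i; apply/existsP; exists j; rewrite lt_ij.
have odd_ij : odd i != odd j.
  by apply/eqP => /(inc_w i j (ltnW lt_ij)); rewrite ltnNge ge_ij.
exists i, j; split=> //; rewrite ltn_neqAle ge_ij andbT.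
by apply/eqP => /val_inj/perm_inj eq_ij; rewrite eq_ij eqxx in odd_ij.
Qed.

(** The letter 3 of the pattern is found just before the end of a far inversion:
    that position is in the parity class of the start i, so its value exceeds
    w i. *)
Lemma faro_avoids231 n (w : 'S_n) :
  faro w && avoids_pattern [:: 2; 3; 1] w = near_identity w.
Proof.
apply/andP/idP => [[faro_w no231] | near_w].
- apply: contraNT no231 => /(faro_far_inversion faro_w)[i [j]].
  case=> lt_ij w_ji odd_ij; have lt_j1 : j.-1 < n by move: (ltn_ord j); lia.
  apply/contains231P; exists i, (Ordinal lt_j1), j; split=> //=; try lia.
  by apply: (elimT (faroP w) faro_w) => /=; lia.
- split; first exact: near_identity_faro.
  apply/contains231P => -[i [j [k [ij jk ki _]]]].
  by have := elimT (near_identityP w) near_w i k; lia.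
Qed.

(** Here the letter 1 is found just after the start of a far inversion: that
    position is in the parity class of the end j, so its value is below w j. *)
Lemma faro_avoids312 n (w : 'S_n) :
  faro w && avoids_pattern [:: 3; 1; 2] w = near_identity w.
Proof.
apply/andP/idP => [[faro_w no312] | near_w].
- apply: contraNT no312 => /(faro_far_inversion faro_w)[i [j]].
  case=> lt_ij w_ji odd_ij; have lt_i1 : i.+1 < n by move: (ltn_ord j); lia.
  apply/contains312P; exists i, (Ordinal lt_i1), j; split=> //=; try lia.
  by apply: (elimT (faroP w) faro_w) => /=; lia.
- split; first exact: near_identity_faro.
  apply/contains312P => -[i [j [k [ij jk _ ki]]]].
  by have := elimT (near_identityP w) near_w i k; lia.
Qed.

(** By induction on i, every smaller point j satisfies w (w j) = j.  If w i < i,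
    apply this to j = w i.  If w i = i + 1, the preimage j of i is within one
    step of i and is neither i nor smaller (else w i = j by induction), so it is
    i + 1 = w i. *)
Lemma near_identity_involution n (w : 'S_n) :
  near_identity w -> is_involution w.
Proof.
move=> /forallP near_w; apply/forallP => i; apply/eqP.
have [m] := ubnP (val i); elim: m i => // m IHm i; rewrite ltnS => le_im.
have [lt_wi | lt_iw | /val_inj wi] := ltngtP (w i) i; last by rewrite !wi.
  by apply: (@perm_inj _ w); apply: IHm; apply: leq_trans le_im.
pose j := (w^-1)%g i; have wj : w j = i by rewrite permKV.
have [lt_ji | lt_ij | /val_inj eq_ji] := ltngtP j i.
- have := IHm j (leq_trans lt_ji le_im); rewrite wj => wi.
  by move: lt_iw; rewrite wi; lia.
- suff -> : w i = j by [].
  apply: val_inj => /=; move: (near_w i) (near_w j); rewrite wj; lia.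
- by move: lt_iw; rewrite -{1}wj eq_ji ltnn.
Qed.

(** Infinite descent.  Suppose i + 2 <= w i.  Since w swaps i and w i, these two
    positions have opposite parities, so i + 1 and w i have the same one and
    k = w (i + 1) < w (w i) = i.  But w k = i + 1 >= k + 2. *)
Lemma faro_involution_le n (w : 'S_n) :
  faro w -> is_involution w -> forall i, w i <= i.+1.
Proof.
move=> /faroP inc_w /forallP inv_w i.
have [m] := ubnP (val i); elim: m i => // m IHm i; rewrite ltnS => le_im.
rewrite leqNgt; apply/negP => lt_i_wi.
have odd_iwi : odd i != odd (w i).
  by apply/eqP => /(inc_w _ _ (ltnW lt_i_wi)); rewrite (eqP (inv_w i)); lia.
have lt_i1 : i.+1 < n by move: (ltn_ord (w i)); lia.
pose k := w (Ordinal lt_i1); have wk : w k = Ordinal lt_i1 by apply/eqP/inv_w.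
have lt_ki : k < i.
  by rewrite -[X in _ < val X](eqP (inv_w i)); apply: inc_w => /=; lia.
by have := IHm k (leq_trans lt_ki le_im); rewrite wk /=; lia.
Qed.

(** The bound w i <= i + 1, applied at the point w i, also bounds i by
    w i + 1. *)
Lemma faro_involutionE n (w : 'S_n) :
  faro w && is_involution w = near_identity w.
Proof.
apply/andP/idP => [[faro_w inv_w] | near_w]; last first.
  by split; [apply: near_identity_faro | apply: near_identity_involution].
apply/forallP => i; rewrite faro_involution_le //=.
by rewrite -[X in val X <= _](eqP (forallP inv_w i)) faro_involution_le.
Qed.

(** * Counting *)

Lemma lift_perm_max n (w : 'S_n.+1) :
  w ord_max = ord_max -> exists s : 'S_n, w = lift_perm ord_max ord_max s.
Proof.
move=> w_max; pose f k := odflt k (unlift ord_max (w (lift ord_max k))).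
have fK k : lift ord_max (f k) = w (lift ord_max k).
  rewrite /f; case: unliftP => [h -> //|]; rewrite -{2}w_max => /perm_inj/eqP.
  by rewrite eq_sym (negbTE (neq_lift _ _)).
have f_inj : injective f.
  move=> h k eq_f; apply/(@lift_inj _ ord_max)/(@perm_inj _ w).
  by rewrite -!fK eq_f.
exists (perm f_inj); apply/permP => i.
case: (unliftP ord_max i) => [k|] ->; last by rewrite lift_perm_id.
by rewrite lift_perm_lift permE fK.
Qed.

Lemma lift_perm_max_inj n : injective (@lift_perm n ord_max ord_max).
Proof.
move=> s t eq_st; apply/permP => i; apply: (@lift_inj _ ord_max).
by rewrite -!(lift_perm_lift ord_max) eq_st.
Qed.

Lemma near_identity_lift n (s : 'S_n) :
  near_identity (lift_perm ord_max ord_max s) = near_identity s.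
Proof.
apply/forallP/forallP => near_s i.
  by have := near_s (lift ord_max i); rewrite lift_perm_lift !lift_max.
case: (unliftP ord_max i) => [k|] ->; last by rewrite lift_perm_id leqnSn.
by rewrite lift_perm_lift !lift_max.
Qed.

(** Extends a permutation of n points by the transposition of two new last
    points; [lift ord_max ord_max] is the last but one. *)
Definition swap_last n (s : 'S_n) : 'S_n.+2 :=
  (tperm ord_max (lift ord_max ord_max) *
   lift_perm ord_max ord_max (lift_perm ord_max ord_max s))%g.

Lemma swap_last_max n (s : 'S_n) : swap_last s ord_max = lift ord_max ord_max.
Proof. by rewrite permM tpermL lift_perm_lift lift_perm_id. Qed.

Lemma swap_last_penult n (s : 'S_n) :
  swap_last s (lift ord_max ord_max) = ord_max.
Proof. by rewrite permM tpermR lift_perm_id. Qed.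

Lemma swap_last_lift n (s : 'S_n) (k : 'I_n) :
  swap_last s (lift ord_max (lift ord_max k)) =
  lift ord_max (lift ord_max (s k)).
Proof.
rewrite permM tpermD ?neq_lift ?(inj_eq (@lift_inj _ _)) ?neq_lift //.
by rewrite !lift_perm_lift.
Qed.

Lemma swap_last_inj n : injective (@swap_last n).
Proof. by move=> s t /mulgI/lift_perm_max_inj/lift_perm_max_inj. Qed.

Lemma near_identity_swap_last n (s : 'S_n) :
  near_identity (swap_last s) = near_identity s.
Proof.
apply/forallP/forallP => near_s i.
  have := near_s (lift ord_max (lift ord_max i)).
  by rewrite swap_last_lift !lift_max.
case: (unliftP ord_max i) => [k|] ->; last first.
  by rewrite swap_last_max lift_max /=; lia.
case: (unliftP ord_max k) => [h|] ->; last first.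
  by rewrite swap_last_penult lift_max /=; lia.
by rewrite swap_last_lift !lift_max.
Qed.

(** The last point can only move down by one, and then, w being an involution,
    the last but one comes back up; composing with their transposition gives a
    permutation fixing both. *)
Lemma near_identity_swap_lastP n (w : 'S_n.+2) :
  near_identity w -> w ord_max != ord_max -> exists s : 'S_n, w = swap_last s.
Proof.
move=> near_w w_max; set p : 'I_n.+2 := lift ord_max ord_max.
have w_maxE : w ord_max = p.
  apply: val_inj; rewrite [RHS]lift_max.
  move/forallP/(_ ord_max): near_w w_max; rewrite -val_eqE /=.
  by move: (ltn_ord (w ord_max)); lia.
have w_p : w p = ord_max.
  by rewrite -w_maxE; apply/eqP/(forallP (near_identity_involution near_w)).
have [t t_w] : exists t, (tperm ord_max p * w)%g = lift_perm ord_max ord_max t.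
  by apply: lift_perm_max; rewrite permM tpermL.
have [s s_t] : exists s, t = lift_perm ord_max ord_max s.
  apply/lift_perm_max/(@lift_inj _ ord_max).
  by rewrite -(lift_perm_lift ord_max) -t_w permM tpermR.
by exists s; rewrite /swap_last -s_t -t_w mulgA tperm2 mul1g.
Qed.

(** The near-identities fixing the last point are the images of
    [lift_perm ord_max ord_max], the others those of [swap_last]. *)
Lemma card_near_identity n : #|[set w : 'S_n | near_identity w]| = fib n.
Proof.
have [m] := ubnP n; elim: m n => // m IHm [|[|n]] lt_n.
- rewrite (_ : [set _ | _] = setT) ?cardsT ?card_Sn //.
  by apply/setP => w; rewrite !inE; apply/forallP => -[].
- rewrite (_ : [set _ | _] = setT) ?cardsT ?card_Sn //.
  by apply/setP => w; rewrite !inE; apply/forallP => i; rewrite !ord1.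
rewrite -(cardsID [set w : 'S_n.+2 | w ord_max == ord_max]).
rewrite -[fib n.+2]/(fib n.+1 + fib n) -!IHm; try lia.
congr (_ + _).
- rewrite -[RHS](card_imset _ (@lift_perm_max_inj _)); apply: eq_card => w.
  rewrite !inE; apply/andP/imsetP => [[near_w /eqP w_max]|[s s_in ->]].
    have [s w_s] := lift_perm_max w_max.
    by exists s; rewrite // inE -near_identity_lift -w_s.
  by rewrite near_identity_lift lift_perm_id eqxx; move: s_in; rewrite inE.
- rewrite -[RHS](card_imset _ (@swap_last_inj _)); apply: eq_card => w.
  rewrite !inE; apply/andP/imsetP => [[w_max near_w]|[s s_in ->]].
    have [s w_s] := near_identity_swap_lastP near_w w_max.
    by exists s; rewrite // inE -near_identity_swap_last -w_s.
  move: s_in; rewrite inE -near_identity_swap_last => ->.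
  by rewrite swap_last_max eq_sym neq_lift.
Qed.

Theorem theorem4p6 (n : nat) (n_ge1 : 1 <= n) :
  [/\ #|faro_B n| = fib n,
      faro_B n = faro_B' n
    & faro_B n = faro_involutions n].
Proof.
have B_near : faro_B n = [set w : 'S_n | near_identity w].
  by apply/setP => w; rewrite !inE faro_avoids231.
split; rewrite B_near; first exact: card_near_identity.
- by apply/setP => w; rewrite !inE faro_avoids312.
- by apply/setP => w; rewrite !inE faro_involutionE.
Qed.
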